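(* Let $m\ge 1$ and for $i=1,\dots,m$ let $G_i$ be a homeomorphism group of a metric space $(X_i,d_i)$. Let $(X,d)=\prod_{i=1}^m(X_i,d_i)$. Then the direct product of groups $G=\prod_{i=1}^m G_i$ is sensitive to initial conditions on $(X,d)$ if and only if there exists $n$, $1\le n\le m$, such that the group $G_n$ is sensitive to initial conditions.
   Context: A homeomorphism group of $X$ is a group of homeomorphisms of $X$ onto itself. The product metric space $(X,d)=\prod_{i=1}^m(X_i,d_i)$ is the Cartesian product $X=\prod_{i=1}^m X_i$ with the metric $d(x,y)=\sum_{i=1}^m\frac{1}{2^i}\widetilde d_i(x_i,y_i)$, where $\widetilde d_i=d_i$ if $d_i$ is bounded by $1$ and $\widetilde d_i=\frac{d_i}{1+d_i}$ otherwise. The group $G=\prod_i G_i$ acts canonically on $X$: $(g_1,\dots,g_m).(x_1,\dots,x_m)=(g_1.x_1,\dots,g_m.x_m)$. A homeomorphism group $G$ of a metric space $(X,d)$ is sensitive to initial conditions if there exists $\delta>0$ such that for every nonempty open subset $U\subset X$ there exists $g\in G$ with $\operatorname{diam}(g.U)\ge\delta$ (the diameter is taken in $[0,\infty]$). *)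

(* Defs.v *)
From HB Require Import structures.
From mathcomp Require Import all_boot all_order all_algebra.
From mathcomp Require Import all_classical all_reals all_analysis.

Set Implicit Arguments.
Unset Strict Implicit.
Unset Printing Implicit Defensive.

Import Order.TTheory GRing.Theory Num.Theory.

Local Open Scope classical_set_scope.
Local Open Scope ring_scope.

Definition homeomorphism (T : topologicalType) (f : T -> T) : Prop :=
  continuous f /\
  exists2 g : T -> T, continuous g & cancel f g /\ cancel g f.

Record homeoGroup (T : topologicalType) := HomeoGroup {
  homeoGroup_set : set (T -> T) ;
  homeoGroup_homeo : forall f, homeoGroup_set f -> homeomorphism f ;
  homeoGroup_id : homeoGroup_set id ;
  homeoGroup_comp : forall f g,
    homeoGroup_set f -> homeoGroup_set g -> homeoGroup_set (f \o g) ;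
  homeoGroup_inv : forall f, homeoGroup_set f ->
    exists2 g, homeoGroup_set g & cancel f g /\ cancel g f }.

(* The element 0 makes the supremum range over [0, +oo], so that the diameter
   of the empty set is 0 and not -oo. *)
Definition diam (R : realType) (T : metricType R) (A : set T) : \bar R :=
  ereal_sup (0%E |` [set (mdist p.1 p.2)%:E | p in A `*` A]).

Definition sensitive (R : realType) (T : metricType R) (G : homeoGroup T) :
    Prop :=
  exists2 delta : R, 0 < delta &
    forall U : set T, open U -> U !=set0 ->
      exists2 g : T -> T, homeoGroup_set G g & (delta%:E <= diam (g @` U))%E.

Definition bounded_mdist (R : realType) (T : metricType R) (x y : T) : R :=
  if `[< forall u v : T, mdist u v <= 1 >] then mdist x y
  else mdist x y / (1 + mdist x y).

(* An alias of the dependent product, so that its topology is the one induced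
   by the metric below; this is not the library's instance on forall i, X i. *)
Definition metric_prod (R : realType) (m : nat) (X : 'I_m -> metricType R) :
  Type := forall i, X i.

(* Coordinates are numbered from 0, hence the weight 1 / 2 ^ (i + 1). *)
Definition prod_mdist (R : realType) (m : nat) (X : 'I_m -> metricType R)
    (x y : metric_prod X) : R :=
  \sum_(i < m) 2 ^- i.+1 * bounded_mdist (x i) (y i).

Section bounded_mdist_theory.
Context {R : realType} {T : metricType R}.
Implicit Types x y z : T.

Lemma bounded_mdist_ge0 x y : 0 <= bounded_mdist x y.
Proof.
rewrite /bounded_mdist; case: ifP => _; first exact: mdist_ge0.
by rewrite divr_ge0 ?addr_ge0 ?mdist_ge0.
Qed.

Lemma bounded_mdistxx x : bounded_mdist x x = 0.
Proof. by rewrite /bounded_mdist mdistxx mul0r if_same. Qed.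

Lemma bounded_mdist_sym x y : bounded_mdist x y = bounded_mdist y x.
Proof. by rewrite /bounded_mdist metric_sym. Qed.

Lemma bounded_mdist_positivity x y : bounded_mdist x y = 0 -> x = y.
Proof.
rewrite /bounded_mdist; case: ifP => _; first exact: mdist_positivity.
move/eqP; rewrite mulf_eq0 invr_eq0 => /orP[/eqP/mdist_positivity//|].
by rewrite gt_eqF// ltr_wpDr// mdist_ge0.
Qed.

Lemma bounded_mdist_triangle y x z :
  bounded_mdist x z <= bounded_mdist x y + bounded_mdist y z.
Proof.
rewrite /bounded_mdist; case: ifP => _; first exact: metric_triangle.
have := metric_triangle x y z.
have := mdist_ge0 x y; have := mdist_ge0 y z; have := mdist_ge0 x z.
move: (mdist x z) (mdist x y) (mdist y z) => c a b c0 b0 a0 cab.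
have p1 (t : R) : 0 <= t -> 0 < 1 + t by move=> t0; rewrite ltr_wpDr.
have E (t : R) : 0 <= t -> t / (1 + t) = 1 - (1 + t)^-1.
  move=> t0; apply: (mulIf (lt0r_neq0 (p1 _ t0))).
  by rewrite mulrBl mul1r divfK ?mulVf ?gt_eqF ?p1// addrC addKr.
have ab0 : 0 <= a + b by rewrite addr_ge0.
apply: (@le_trans _ _ ((a + b) / (1 + (a + b)))).
  by rewrite !E// lerB// lef_pV2 ?posrE ?p1// lerD2l.
rewrite mulrDl lerD// ler_wpM2l// lef_pV2 ?posrE ?p1// lerD2l.
  by rewrite lerDl.
by rewrite lerDr.
Qed.

Lemma bounded_mdist_le x y : bounded_mdist x y <= mdist x y.
Proof.
rewrite /bounded_mdist; case: ifP => // _.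
by rewrite ler_pdivrMr ?ltr_wpDr ?mdist_ge0// ler_peMr ?mdist_ge0// lerDl mdist_ge0.
Qed.

Lemma bounded_mdist_lt (e : R) x y : 0 < e ->
  bounded_mdist x y < e / (1 + e) -> mdist x y < e.
Proof.
move=> e0; have e1 : 0 < 1 + e by rewrite addr_gt0.
have d1 : 0 < 1 + mdist x y by rewrite ltr_wpDr// mdist_ge0.
rewrite /bounded_mdist; case: ifP => _.
  move=> /lt_le_trans; apply; rewrite ler_pdivrMr// ler_peMr ?ltW//.
  by rewrite ltrDl.
rewrite ltr_pdivrMr// mulrAC ltr_pdivlMr// !mulrDr !mulr1.
by rewrite [e * _]mulrC ltrD2r.
Qed.

End bounded_mdist_theory.

Section metric_prod.
Context {R : realType} {m : nat} (X : 'I_m -> metricType R).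
Implicit Types x y z : metric_prod X.

Let term_ge0 x y (i : 'I_m) : 0 <= 2 ^- i.+1 * bounded_mdist (x i) (y i).
Proof. by rewrite mulr_ge0 ?bounded_mdist_ge0// invr_ge0 exprn_ge0. Qed.

Let prod_mdistxx x : prod_mdist x x = 0.
Proof. by rewrite /prod_mdist big1// => i _; rewrite bounded_mdistxx mulr0. Qed.

Let prod_mdist_positivity x y : prod_mdist x y = 0 -> x = y.
Proof.
move/eqP; rewrite /prod_mdist psumr_eq0// => /allP xy.
apply: functional_extensionality_dep => i.
have := xy i (mem_index_enum i); rewrite /= mulf_eq0 invr_eq0 expf_eq0/=.
by rewrite pnatr_eq0/= => /eqP/bounded_mdist_positivity.
Qed.

Let prod_mdist_sym x y : prod_mdist x y = prod_mdist y x.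
Proof. by apply: eq_bigr => i _; rewrite bounded_mdist_sym. Qed.

Let prod_mdist_triangle y x z :
  prod_mdist x z <= prod_mdist x y + prod_mdist y z.
Proof.
rewrite /prod_mdist -big_split/=; apply: ler_sum => i _; rewrite -mulrDr.
by rewrite ler_wpM2l ?bounded_mdist_triangle// invr_ge0 exprn_ge0.
Qed.

HB.instance Definition _ := gen_eqMixin (metric_prod X).
HB.instance Definition _ := gen_choiceMixin (metric_prod X).
HB.instance Definition _ := isMetric.Build R (metric_prod X)
  prod_mdistxx prod_mdist_positivity prod_mdist_sym prod_mdist_triangle.

Lemma mdist_prodE x y :
  mdist x y = \sum_(i < m) 2 ^- i.+1 * bounded_mdist (x i) (y i).
Proof. by []. Qed.

Lemma le_mdist_prod x y (i : 'I_m) :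
  2 ^- i.+1 * bounded_mdist (x i) (y i) <= mdist x y.
Proof. by rewrite mdist_prodE (bigD1 i)//= lerDl sumr_ge0. Qed.

Definition prod_act (h : forall i, X i -> X i) (x : metric_prod X) :
  metric_prod X := fun i => h i (x i).

Lemma prod_act_continuous (h : forall i, X i -> X i) :
  (forall i, continuous (h i)) -> continuous (prod_act h).
Proof.
move=> hc x; apply/(@metricType_numDomainType.cvgrPdist_lt _ _ _ _ (nbhs_filter x)) => e e0.
pose e' := e / m.+1%:R; have e'0 : 0 < e' by rewrite divr_gt0.
have : \forall y \near x, forall i, mdist (h i (x i)) (h i (y i)) < e'.
  apply: (@filter_forall _ _ _ _ (nbhs_filter x)) => i.
  have /metricType_numDomainType.cvgrPdist_lt/(_ _ e'0) := hc i (x i).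
  move=> /metricType_numDomainType.nbhs_mdistP[d /= d0 dh].
  apply/(@metricType_numDomainType.nbhs_mdistP _ (metric_prod X)).
  have w0 : 0 < 2 ^- i.+1 :> R by rewrite invr_gt0 exprn_gt0.
  exists (2 ^- i.+1 * (d / (1 + d))) => /=.
    by rewrite mulr_gt0// divr_gt0// addr_gt0.
  move=> y /= xy; apply: dh => /=; apply: bounded_mdist_lt => //.
  by rewrite -(ltr_pM2l w0) (le_lt_trans _ xy)// le_mdist_prod.
apply: (@filterS _ _ (nbhs_filter x)) => y xy; rewrite mdist_prodE.
apply: (@le_lt_trans _ _ (\sum_(i < m) e')).
  apply: ler_sum => i _; apply: (le_trans _ (ltW (xy i))).
  apply: (le_trans _ (bounded_mdist_le _ _)).
  rewrite ler_piMl ?bounded_mdist_ge0// invf_le1 ?exprn_gt0//.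
  by rewrite exprn_ege1// ler1n.
rewrite sumr_const card_ord -mulr_natr /e' mulrAC ltr_pdivrMr//.
by rewrite ltr_pM2l// ltr_nat.
Qed.

Definition prod_homeoGroup_set (G : forall i, homeoGroup (X i)) :
    set (metric_prod X -> metric_prod X) :=
  [set prod_act h | h in [set h | forall i, homeoGroup_set (G i) (h i)]].

Section prod_homeoGroup.
Variable G : forall i, homeoGroup (X i).

Let prod_homeoGroup_inv f : prod_homeoGroup_set G f ->
  exists2 g, prod_homeoGroup_set G g & cancel f g /\ cancel g f.
Proof.
move=> [h Gh <-].
have inv i : {k | homeoGroup_set (G i) k /\ (cancel (h i) k /\ cancel k (h i))}.
  by apply: cid; have [k Gk hk] := homeoGroup_inv (Gh i); exists k.
exists (prod_act (fun i => sval (inv i))).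
  by exists (fun i => sval (inv i)) => // i; case: (svalP (inv i)).
by split=> x; apply: functional_extensionality_dep => i;
  rewrite /prod_act; case: (svalP (inv i)) => _ [].
Qed.

Let prod_homeoGroup_homeo f : prod_homeoGroup_set G f -> homeomorphism f.
Proof.
have Gc g : prod_homeoGroup_set G g -> continuous g.
  move=> [h Gh <-]; apply: prod_act_continuous => i.
  by have [] := homeoGroup_homeo (Gh i).
move=> Gf; split; first exact: Gc.
by have [g Gg fg] := prod_homeoGroup_inv Gf; exists g => //; exact: Gc.
Qed.

Let prod_homeoGroup_id : prod_homeoGroup_set G id.
Proof. by exists (fun=> id) => // i; exact: homeoGroup_id. Qed.

Let prod_homeoGroup_comp f g : prod_homeoGroup_set G f ->
  prod_homeoGroup_set G g -> prod_homeoGroup_set G (f \o g).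
Proof.
move=> [h Gh <-] [k Gk <-]; exists (fun i => h i \o k i) => // i.
exact: homeoGroup_comp.
Qed.

(* The direct product of the groups G i, seen through its canonical action as
   a homeomorphism group of the product metric space. *)
Definition prod_homeoGroup : homeoGroup (metric_prod X) :=
  HomeoGroup prod_homeoGroup_homeo prod_homeoGroup_id prod_homeoGroup_comp
    prod_homeoGroup_inv.

End prod_homeoGroup.

End metric_prod.

(* Main.v *)
Require Import Defs.
From mathcomp Require Import all_boot all_order all_algebra.
From mathcomp Require Import all_classical all_reals all_analysis.

(** Replacing the [n]-th coordinate of a point embeds [X n] continuously in the
    product and scales the bounded metric by [2 ^- n.+1]. Hence an open set of
    the product contains an embedded copy of a nonempty open set of [X n], which
    an element of [G n], extended by the identity, stretches. Conversely, if for
    every [i] some nonempty open [U i] has only small images under [G i], then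
    all images of the box with sides [U i] are small, since the product distance
    is at most the sum of the coordinate distances. *)

Import Order.TTheory GRing.Theory Num.Theory metricType_numDomainType.

Local Open Scope classical_set_scope.
Local Open Scope ring_scope.

Section diam.
Context {R : realType} {T : metricType R}.
Implicit Type A : set T.

Lemma le_diam A x y : A x -> A y -> ((mdist x y)%:E <= diam A)%E.
Proof. by move=> Ax Ay; apply: ereal_sup_ubound; right; exists (x, y). Qed.

Lemma diam_le A (c : R) : 0 <= c ->
  (forall x y, A x -> A y -> mdist x y <= c) -> (diam A <= c%:E)%E.
Proof.
move=> c0 Ac; apply: ge_ereal_sup => _ [->|[[x y] [/= Ax Ay] <-]].
  by rewrite lee_fin.
by rewrite lee_fin Ac.
Qed.

(** A value above [c] occurs in the supremum, and [0 <= c] excludes the adjoined value [0], so it is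
    a distance. *)
Lemma lt_diam A (c : R) : 0 <= c -> (c%:E < diam A)%E ->
  exists x y, [/\ A x, A y & c < mdist x y].
Proof.
move=> c0 /ereal_sup_gt[_ [->|[[x y] [/= Ax Ay] <-]]]; rewrite lte_fin => cA.
  by have := le_lt_trans c0 cA; rewrite ltxx.
by exists x, y.
Qed.

Lemma not_sensitive_open (G : homeoGroup T) (e : R) : 0 < e -> ~ sensitive G ->
  exists U : set T, [/\ open U, U !=set0 &
    forall g, homeoGroup_set G g -> (diam (g @` U) < e%:E)%E].
Proof.
move=> e0 nG; apply: contrapT => nU; apply: nG; exists e => // U oU U0.
apply: contrapT => ng; apply: nU; exists U; split=> // g Gg.
by rewrite ltNge; apply/negP => eg; apply: ng; exists g.
Qed.

End diam.

Section metric_prod.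
Context {R : realType} {m : nat} {X : 'I_m -> metricType R}.
Implicit Types (x y : metric_prod X) (n : 'I_m).

Let w_gt0 n : 0 < 2 ^- n.+1 :> R.
Proof. by rewrite invr_gt0 exprn_gt0. Qed.

Let w_le1 n : 2 ^- n.+1 <= 1 :> R.
Proof. by rewrite invf_le1 ?exprn_gt0// exprn_ege1// ler1n. Qed.

Lemma mdist_prod_le x y : mdist x y <= \sum_(i < m) mdist (x i) (y i).
Proof.
rewrite mdist_prodE; apply: ler_sum => i _.
apply: le_trans (bounded_mdist_le _ _).
by rewrite ler_piMl// bounded_mdist_ge0.
Qed.

Lemma metric_prod_proj_continuous n :
  continuous ((fun x => x n) : metric_prod X -> X n).
Proof.
move=> x; apply/(@cvgrPdist_lt _ _ _ _ (nbhs_filter x)) => e e0.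
apply/(@nbhs_mdistP _ (metric_prod X)).
(* The [n]-th term is at most the whole sum, so this radius keeps the [n]-th bounded distance below
   [e / (1 + e)], which forces [mdist] below [e]. *)
exists (2 ^- n.+1 * (e / (1 + e))) => /=.
  by rewrite mulr_gt0// divr_gt0// addr_gt0.
move=> y /= xy; apply: bounded_mdist_lt => //.
by rewrite -(ltr_pM2l (w_gt0 n)) (le_lt_trans _ xy)// le_mdist_prod.
Qed.

(** There are finitely many coordinates, so the preimages of the sides intersect in a
    neighbourhood. *)
Lemma open_box (U : forall i, set (X i)) : (forall i, open (U i)) ->
  open [set x : metric_prod X | forall i, U i (x i)].
Proof.
move=> oU; rewrite openE => x Ux.
apply: (@filter_forall _ _ _ _ (nbhs_filter x)) => i.
apply: (metric_prod_proj_continuous i x).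
by apply: open_nbhs_nbhs; split; [exact: oU|exact: Ux].
Qed.

Definition replace_coord x n (u : X n) : metric_prod X :=
  dfwith x n u.

Lemma replace_coord_same x n (u : X n) : replace_coord x n u n = u.
Proof. exact: dfwithin. Qed.

Lemma replace_coord_id x n : replace_coord x n (x n) = x.
Proof.
by apply: functional_extensionality_dep => i; rewrite /replace_coord; case: dfwithP.
Qed.

Lemma mdist_replace_coord x n (u v : X n) :
  mdist (replace_coord x n u) (replace_coord x n v) =
  2 ^- n.+1 * bounded_mdist u v.
Proof.
rewrite mdist_prodE (bigD1 n)//= !replace_coord_same big1 ?addr0// => i ni.
by rewrite /replace_coord !dfwithout 1?eq_sym// bounded_mdistxx mulr0.
Qed.

(** The embedding is 1-Lipschitz: the weight is at most 1 and [bounded_mdist] is at most [mdist]. *)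
Lemma replace_coord_continuous x n : continuous (replace_coord x n).
Proof.
move=> u; apply/cvgrPdist_lt => e e0.
apply/nbhs_mdistP; exists e => //= v /= uv.
rewrite mdist_replace_coord; apply: le_lt_trans uv.
apply: le_trans (bounded_mdist_le _ _).
by rewrite ler_piMl// bounded_mdist_ge0.
Qed.

Lemma sensitive_prod_factor (G : forall i, homeoGroup (X i)) n :
  sensitive (G n) -> sensitive (prod_homeoGroup G).
Proof.
move=> [d d0 Gd].
(* The supremum defining a diameter need not be attained; halving [d] leaves room to pick two actual
   points. *)
have e0 : 0 < d / 2 by rewrite divr_gt0.
exists (2 ^- n.+1 * (d / 2 / (1 + d / 2))).
  by rewrite mulr_gt0// divr_gt0// addr_gt0.
move=> U oU [x Ux].
have oV : open (replace_coord x n @^-1` U).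
  by apply: open_comp => // u _; exact: replace_coord_continuous.
have [|g Gg dg] := Gd _ oV.
  by exists (x n); rewrite /preimage/= replace_coord_id.
have /lt_diam[|_ [_ [[u Uu <-] [v Uv <-] guv]]] :
    ((d / 2)%:E < diam (g @` (replace_coord x n @^-1` U)))%E.
- by apply: lt_le_trans dg; rewrite lte_fin ltr_pdivrMr// ltr_pMr// ltr1n.
- exact: ltW.
pose h : forall i, X i -> X i := dfwith (fun=> id) n g.
(* The embedding intertwines [g] with its extension by the identity. *)
have hE w : prod_act h (replace_coord x n w) = replace_coord x n (g w).
  apply: functional_extensionality_dep => i; rewrite /prod_act /h /replace_coord.
  have [<-|ni] := eqVneq n i; first by rewrite !dfwithin.
  by rewrite !dfwithout.
exists (prod_act h).
  exists h => // i; rewrite /h; case: dfwithP => // j _.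
  exact: homeoGroup_id.
have img w : U (replace_coord x n w) ->
    (prod_act h @` U) (replace_coord x n (g w)).
  by rewrite -hE; exists (replace_coord x n w).
apply: le_trans (le_diam _ _ _ (img _ Uu) (img _ Uv)).
rewrite mdist_replace_coord lee_fin ler_pM2l// leNgt.
(* A bounded distance below [t / (1 + t)] with [t = d / 2] would put the two image points closer
   than [d / 2]. *)
apply/negP => /(bounded_mdist_lt e0).
by rewrite ltNge (ltW guv).
Qed.

Lemma sensitive_factor_prod (G : forall i, homeoGroup (X i)) :
  sensitive (prod_homeoGroup G) -> exists n, sensitive (G n).
Proof.
move=> [d d0 Gd]; apply: contrapT => nG.
(* With [m.+1] in place of [m], the sum of [m] copies of [e] stays strictly below [d]; [diam_le]
   alone gives only a weak bound. *)
pose e := d / m.+1%:R; have e0 : 0 < e by rewrite divr_gt0.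
have smallU i : {U : set (X i) | [/\ open U, U !=set0 &
    forall g, homeoGroup_set (G i) g -> (diam (g @` U) < e%:E)%E]}.
  by apply/cid/not_sensitive_open => // Gi; apply: nG; exists i.
pose U i := sval (smallU i).
have oU i : open (U i) by case: (svalP (smallU i)).
have U0 i : {y | U i y} by apply: cid; case: (svalP (smallU i)).
have gU i g : homeoGroup_set (G i) g -> (diam (g @` U i) < e%:E)%E.
  by case: (svalP (smallU i)) => _ _; exact.
have [|_ [h Gh <-]] := Gd _ (open_box U oU).
  by exists (fun i => sval (U0 i)) => i; exact: svalP (U0 i).
apply/negP; rewrite -ltNge.
apply: (@le_lt_trans _ _ (e *+ m)%:E); last first.
  rewrite lte_fin /e -mulr_natr mulrAC ltr_pdivrMr//.
  by rewrite ltr_pM2l// ltr_nat.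
apply: diam_le; first by rewrite mulrn_wge0// ltW.
move=> _ _ [x Ux <-] [y Uy <-]; apply: le_trans (mdist_prod_le _ _) _.
rewrite -[m in leRHS]card_ord -sumr_const; apply: ler_sum => i _.
rewrite -lee_fin; apply: le_trans (ltW (gU i _ (Gh i))).
by apply: le_diam; eexists; [exact: Ux| |exact: Uy|].
Qed.

End metric_prod.

Theorem theorem6p16 (R : realType) (m : nat) (hm : (1 <= m)%N)
    (X : 'I_m -> metricType R) (G : forall i : 'I_m, homeoGroup (X i)) :
  sensitive (prod_homeoGroup G) <-> exists n : 'I_m, sensitive (G n).
Proof.
split; first exact: sensitive_factor_prod.
by move=> [n]; exact: sensitive_prod_factor.
Qed.
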